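(* Let $(\phi^n,R^n)_{n\ge 0}$ be generated by the first-order PS-SAV scheme $$\frac{\phi^{n+1}-\phi^n}{\Delta t}=-M\mu^{n+1},$$ $$\mu^{n+1}=s\epsilon^2(A\phi^{n+1}-A\phi^{n})+\frac{R^{n+1}}{E(\phi^n)+C}\left[\epsilon^2A\phi^{n}+F'(\phi^n)\right],$$ $$\frac{R^{n+1}-R^n}{\Delta t}=-\frac{1}{M}\left(\frac{\phi^{n+1}-\phi^n}{\Delta t},\frac{\phi^{n+1}-\phi^n}{\Delta t}\right).$$ Given $R^0>0$, we have $R^n>0$ for all $n$, and for every time step $\Delta t>0$ (unconditional energy stability) $$R^{n+1}-R^{n}=-\frac{\Delta t}{M}\left(\frac{\phi^{n+1}-\phi^n}{\Delta t},\frac{\phi^{n+1}-\phi^n}{\Delta t}\right)\leq 0 .$$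
   Context: $(\cdot,\cdot)$ is the $L^2(\Omega)$ inner product. $E(\phi)=\frac{\epsilon^2}{2}(A\phi,\phi)+\int_\Omega F(\phi(\mathbf{x}))\,d\mathbf{x}$, where $\epsilon>0$, $A$ is a linear self-adjoint elliptic operator (periodic or homogeneous Neumann boundary conditions) and $F$ is a nonlinear potential; $C>0$ is a constant such that $E(\phi)+C>0$ for all $\phi$; $M>0$ is the mobility and $s>0$ a stabilizing constant. The scheme approximates the $L^2$ gradient flow $\phi_t=-M(\epsilon^2A\phi+F'(\phi))$ with auxiliary variable $R(t)=E(\phi(t))+C$. ''Generated by the scheme'' means the following: given $\phi^n,R^n$, let $\phi_1^{n+1}$ be the solution of the linear equation $(E(\phi^n)+C)(I+Ms\epsilon^2\Delta tA)\phi_1^{n+1}=-M[\epsilon^2A\phi^{n}+F'(\phi^n)]$ (assumed solvable at each step). If $\phi_1^{n+1}=0$, set $\phi^{n+1}=\phi^n$, $R^{n+1}=R^n$. If $\phi_1^{n+1}\ne0$, set $$R^{n+1}=\frac{-\frac{M}{\Delta t}+\sqrt{\frac{M^2}{\Delta t^2}+4\frac{M}{\Delta t}R^n(\phi_1^{n+1},\phi_1^{n+1})}}{2(\phi_1^{n+1},\phi_1^{n+1})},\qquad \phi^{n+1}=\phi^n+\Delta t\,R^{n+1}\phi_1^{n+1}.$$ This is the solution of the three scheme equations selected by the paper. *)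

(* Defs.v *)
From HB Require Import structures.
From mathcomp Require Import all_boot all_order all_algebra.
From mathcomp Require Import all_classical all_reals all_analysis.
Set Implicit Arguments.
Unset Strict Implicit.
Unset Printing Implicit Defensive.
Import Order.TTheory GRing.Theory Num.Theory.
Import numFieldNormedType.Exports.
Local Open Scope classical_set_scope.
Local Open Scope ring_scope.

(* Product (= Borel) sigma-algebra on R^d, see open_measurable_rV. *)
Section rV_measurable.
Context (R : realType) (d : nat).

Definition rV_coord (i : 'I_d) (x : 'rV[R]_d) : R := x ord0 i.

Let rV_set0 : g_sigma_preimage rV_coord set0.
Proof. exact: sigma_algebra0. Qed.

Let rV_setC A : g_sigma_preimage rV_coord A -> g_sigma_preimage rV_coord (~` A).
Proof. exact: sigma_algebraC. Qed.

Let rV_bigcup (F : (set 'rV[R]_d)^nat) :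
  (forall i, g_sigma_preimage rV_coord (F i)) ->
  g_sigma_preimage rV_coord (\bigcup_i (F i)).
Proof. exact: sigma_algebra_bigcup. Qed.

HB.instance Definition _ := @isMeasurable.Build default_measure_display
  'rV[R]_d (g_sigma_preimage rV_coord) rV_set0 rV_setC rV_bigcup.

Lemma measurable_rV_coord (i : 'I_d) :
  measurable_fun [set: 'rV[R]_d] (rV_coord i).
Proof.
move=> _ Y mY; rewrite setTI; apply: sub_sigma_algebra => /=.
rewrite -bigcup_seq/=; exists i => /=; first by rewrite mem_index_enum.
by exists Y => //; rewrite setTI.
Qed.

Lemma measurable_fun_rV d1 (T1 : measurableType d1) (f : T1 -> 'rV[R]_d) :
  (forall i, measurable_fun [set: T1] (rV_coord i \o f)) ->
  measurable_fun [set: T1] f.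
Proof.
move=> mf _ A mA; rewrite setTI.
suff: g_sigma_preimage rV_coord `<=` [set B | measurable (f @^-1` B)] by apply.
apply: smallest_sub => /=.
- split => //=.
  + by rewrite preimage_set0.
  + by move=> B mB; rewrite setTD preimage_setC; exact: measurableC.
  + by move=> F mF; rewrite preimage_bigcup; exact: bigcup_measurable.
- move=> B; rewrite -bigcup_seq => -[i _ [C mC <-]] /=.
  rewrite setTI -comp_preimage -[X in measurable X]setTI.
  exact: mf.
Qed.

Lemma open_measurable_rV (U : set 'rV[R]_d) : open U -> measurable U.
Proof.
move=> oU.
pose B (q : 'rV[rat]_d) (n : nat) : set 'rV[R]_d :=
  [set x | forall i, `|x ord0 i - ratr (q ord0 i)| < n.+1%:R^-1].
have mB q n : measurable (B q n).
  have -> : B q n = \big[setI/setT]_(i < d)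
      (rV_coord i @^-1` [set y | `|y - ratr (q ord0 i)| < n.+1%:R^-1]).
    apply/seteqP; split => [x Bx|x].
      by rewrite -bigcap_seq => i _; exact: Bx.
    by rewrite -bigcap_seq => Bx i; apply: Bx => /=; rewrite mem_index_enum.
  apply: bigsetI_measurable => i _; rewrite -[X in measurable X]setTI.
  apply: measurable_rV_coord => //.
  have -> : [set y | `|y - ratr (q ord0 i)| < n.+1%:R^-1] = ([set` `](ratr (q ord0 i) - n.+1%:R^-1 : R), (ratr (q ord0 i) + n.+1%:R^-1)[] : set R).
    by apply/funext => y; apply/propext; rewrite /= in_itv/= ltr_distl.
  exact: measurable_itv.
have -> : U = \bigcup_(p in [set p : 'rV[rat]_d * nat | B p.1 p.2 `<=` U]) B p.1 p.2.
  apply/seteqP; split; last by move=> x [p /= pU] /pU.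
  move=> x Ux.
  have : nbhs x U by exact: open_nbhs_nbhs.
  move=> /nbhs_ballP[e /= e0 xeU].
  have [n ne] : exists n : nat, n.+1%:R^-1 < e / 2.
    exists (Num.truncn (e / 2)^-1); rewrite invf_plt ?posrE ?divr_gt0//.
    exact: truncnS_gt.
  have [q qx] : exists q : 'rV[rat]_d, forall i, `|x ord0 i - ratr (q ord0 i)| < n.+1%:R^-1.
    have : forall i : 'I_d, exists q : rat, `|x ord0 i - ratr q| < n.+1%:R^-1.
      move=> i.
      have xn : x ord0 i - n.+1%:R^-1 < x ord0 i + n.+1%:R^-1.
        by rewrite ltrBlDr -addrA ltrDl addr_gt0// invr_gt0.
      have [q] := rat_in_itvoo xn; rewrite in_itv/= => /andP[q1 q2].
      by exists q; rewrite distrC ltr_distl q1.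
    move=> /choice[f fP]; exists (\row_i f i) => i.
    by rewrite mxE.
  exists (q, n) => //= y yB; apply: xeU.
  rewrite /ball/=; split=> // i j; rewrite (ord1 i) /ball /=.
  have -> : x ord0 j - y ord0 j =
    (x ord0 j - ratr (q ord0 j)) - (y ord0 j - ratr (q ord0 j)) by rewrite opprB addrA subrK.
  rewrite (le_lt_trans (ler_normB _ _))// (splitr e) ltrD//; exact: lt_trans ne.
rewrite bigcup_mkcond; apply: countable_bigcupT_measurable => [|p].
  exact: countableP.
by case: ifP.
Qed.

End rV_measurable.

Section lebesgue_rV.
Context (R : realType).

Definition rV_cons d (p : R * 'rV[R]_d) : 'rV[R]_d.+1 :=
  \row_i (if unlift ord0 i is Some j then p.2 ord0 j else p.1).

Definition rV_uncons d (x : 'rV[R]_d.+1) : R * 'rV[R]_d :=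
  (x ord0 ord0, \row_j x ord0 (lift ord0 j)).

Lemma rV_consK d : cancel (@rV_cons d) (@rV_uncons d).
Proof.
move=> [a x]; rewrite /rV_uncons mxE unlift_none; congr pair.
by apply/rowP => j; rewrite !mxE liftK.
Qed.

Lemma measurable_rV_cons d : measurable_fun [set: R * 'rV[R]_d] (@rV_cons d).
Proof.
apply: measurable_fun_rV => i.
case: (unliftP ord0 i) => [j ->|->].
  rewrite (_ : _ \o _ = rV_coord j \o snd); last first.
    by apply/funext => p /=; rewrite /rV_coord mxE liftK.
  by apply: measurableT_comp => //; exact: measurable_rV_coord.
rewrite (_ : _ \o _ = fst); first exact: measurable_fst.
by apply/funext => p /=; rewrite /rV_coord mxE unlift_none.
Qed.

Lemma measurable_rV_uncons d :
  measurable_fun [set: 'rV[R]_d.+1] (@rV_uncons d).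
Proof.
apply: measurable_fun_pair; first exact: (measurable_rV_coord ord0).
apply: measurable_fun_rV => i.
rewrite (_ : _ \o _ = rV_coord (lift ord0 i)); first exact: measurable_rV_coord.
by apply/funext => p /=; rewrite /rV_coord mxE.
Qed.

Section cons_measure.
Context d (m : {sigma_finite_measure set 'rV[R]_d -> \bar R}).

Definition rV_cons_measure : set 'rV[R]_d.+1 -> \bar R :=
  pushforward (lebesgue_measure \x m)%E (@rV_cons d).

Let m0 : rV_cons_measure set0 = 0%E.
Proof. by rewrite /rV_cons_measure /pushforward preimage_set0 measure0. Qed.

Let m_ge0 A : (0 <= rV_cons_measure A)%E.
Proof. by rewrite /rV_cons_measure /pushforward; exact: measure_ge0. Qed.

Let m_additive : semi_sigma_additive rV_cons_measure.
Proof.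
move=> F mF tF mUF; rewrite /rV_cons_measure /pushforward preimage_bigcup.
apply: measure_semi_sigma_additive.
- by move=> n; rewrite -[X in measurable X]setTI; exact: measurable_rV_cons.
- apply/trivIsetP => /= i j _ _ ij; rewrite -preimage_setI.
  by move/trivIsetP : tF => /(_ _ _ _ _ ij) ->//; rewrite preimage_set0.
- by rewrite -preimage_bigcup -[X in measurable X]setTI; exact: measurable_rV_cons.
Qed.

HB.instance Definition _ := isMeasure.Build _ _ _ rV_cons_measure
  m0 m_ge0 m_additive.

Let m_sigma_finite : sigma_finite setT rV_cons_measure.
Proof.
have /sigma_finiteP[F [FT ndF Foo]] := sigma_finiteT (@lebesgue_measure R).
have /sigma_finiteP[G [GT ndG Goo]] := sigma_finiteT m.
exists (fun n => @rV_uncons d @^-1` (F n `*` G n)).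
  rewrite -preimage_bigcup (_ : \bigcup_i _ = setT) ?preimage_setT//.
  apply/seteqP; split => // -[x y] _.
  have [/= n _ Fnx] : (\bigcup_n F n) x by rewrite -FT.
  have [/= k _ Gky] : (\bigcup_n G n) y by rewrite -GT.
  exists (maxn n k) => //; split => /=.
  - by move: x Fnx; exact/subsetPset/ndF/leq_maxl.
  - by move: y Gky; exact/subsetPset/ndG/leq_maxr.
move=> n; have [mFn Fnoo] := Foo n; have [mGn Gnoo] := Goo n.
have mFG : measurable (F n `*` G n) by exact: measurableX.
split.
  by rewrite -[X in measurable X]setTI; exact: measurable_rV_uncons.
rewrite /rV_cons_measure /pushforward -comp_preimage.
rewrite (_ : _ \o _ = id); last by apply/funext => p /=; rewrite rV_consK.
by rewrite preimage_id product_measure1E// lte_mul_pinfty// ge0_fin_numE.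
Qed.

HB.instance Definition _ := Measure_isSigmaFinite.Build _ _ _ rV_cons_measure
  m_sigma_finite.

End cons_measure.

(* Lebesgue measure on R^d; its values on boxes are given by lebesgue_rV_box. *)
Fixpoint lebesgue_rV (d : nat) : {sigma_finite_measure set 'rV[R]_d -> \bar R} :=
  match d with
  | 0%N => \d_(0 : 'rV[R]_0)
  | d'.+1 => rV_cons_measure (lebesgue_rV d')
  end.

Lemma lebesgue_rV_box d (A : 'I_d -> set R) : (forall i, measurable (A i)) ->
  lebesgue_rV d [set x | forall i, A i (x ord0 i)] =
  (\prod_(i < d) lebesgue_measure (A i))%E.
Proof.
elim: d A => [|d IH] A mA.
  rewrite big_ord0 (_ : [set _ | _] = setT); first by rewrite /= diracT.
  by apply/seteqP; split => // x _ [].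
pose B := [set x : 'rV[R]_d | forall i : 'I_d, A (lift ord0 i) (x ord0 i)].
have mB : measurable B.
  have -> : B = \big[setI/setT]_(i < d) (rV_coord i @^-1` (A (lift ord0 i))).
    apply/seteqP; split => [x Bx|x].
      by rewrite -bigcap_seq => i _; exact: Bx.
    by rewrite -bigcap_seq => Bx i; apply: Bx => /=; rewrite mem_index_enum.
  apply: bigsetI_measurable => i _; rewrite -[X in measurable X]setTI.
  exact: measurable_rV_coord.
rewrite big_ord_recl/= /rV_cons_measure /pushforward.
rewrite (_ : _ @^-1` _ = A ord0 `*` B).
  rewrite (product_measure1E lebesgue_measure (lebesgue_rV d) (mA ord0) mB); congr (_ * _)%E.
  by rewrite -(IH (fun i => A (lift ord0 i)) (fun i => mA _)).
apply/seteqP; split => [[a x] /= Ax|[a x] /= [Aa Ax] i].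
  split; first by have := Ax ord0; rewrite mxE unlift_none.
  by move=> i; have := Ax (lift ord0 i); rewrite mxE liftK.
by case: (unliftP ord0 i) => [j ->|->]; rewrite mxE ?liftK ?unlift_none//.
Qed.

End lebesgue_rV.

(* L^2(Omega) is represented by functions 'rV[R]_d -> R; only their values on
   Omega matter, and equality in L^2(Omega) is equality almost everywhere
   on Omega. *)
Section L2.
Context (R : realType) (d : nat) (Omega : set 'rV[R]_d).
Implicit Types u v : 'rV[R]_d -> R.

Definition L2 u :=
  measurable_fun Omega u /\
  (lebesgue_rV R d).-integrable Omega (fun x => (u x ^+ 2)%:E).

Definition L2_eq u v := u = v %[ae (lebesgue_rV R d) in Omega].

Definition inner u v : R := \int[lebesgue_rV R d]_(x in Omega) (u x * v x).

Definition L2_dist2 u v : R := inner (u \- v) (u \- v).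

End L2.

Section unbounded_operators.
Context (R : realType) (d : nat) (Omega : set 'rV[R]_d).
Context (D : set ('rV[R]_d -> R)) (A : ('rV[R]_d -> R) -> 'rV[R]_d -> R).

Record linear_operator : Prop := LinearOperator {
  dom_L2 : forall u, D u -> L2 Omega u;
  range_L2 : forall u, D u -> L2 Omega (A u);
  dom_cst0 : D (cst 0);
  dom_linear : forall a u v, D u -> D v -> D (fun x => a * u x + v x);
  op_linear : forall a u v, D u -> D v ->
    L2_eq Omega (A (fun x => a * u x + v x)) (fun x => a * A u x + A v x) }.

(* A is densely defined and the graph of its adjoint is the graph of A. *)
Record self_adjoint : Prop := SelfAdjoint {
  dom_dense : forall f, L2 Omega f -> forall e : R, 0 < e ->
    exists2 u, D u & L2_dist2 Omega u f < e;
  adjointE : forall v w, L2 Omega v -> L2 Omega w ->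
    (forall u, D u -> inner Omega (A u) v = inner Omega u w) <->
    (D v /\ L2_eq Omega (A v) w) }.

End unbounded_operators.

Section differential_operators.
Context (R : realType) (d : nat).
Implicit Types (u : 'rV[R]_d -> R) (Omega : set 'rV[R]_d).

Definition basis_vec (i : 'I_d) : 'rV[R]_d := delta_mx ord0 i.

(* Iterated partial derivative in the directions listed in s. *)
Definition pderiv (s : seq 'I_d) u : 'rV[R]_d -> R :=
  foldr (fun i f x => 'D_(basis_vec i) f x) u s.

Definition Ck Omega (k : nat) u :=
  (forall (s : seq 'I_d) (i : 'I_d) x, (size s < k)%N -> Omega x ->
     derivable (pderiv s u) x (basis_vec i)) /\
  (forall (s : seq 'I_d) x, (size s <= k)%N -> Omega x ->
     {for x, continuous (pderiv s u)}).

(* Coefficients of a differential operator: a j (i_1, ..., i_j) multiplies the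
   partial derivative of order j in the directions i_1, ..., i_j. *)
Definition coefficients := forall j : nat, j.-tuple 'I_d -> 'rV[R]_d -> R.

Definition diffop (k : nat) (a : coefficients) u : 'rV[R]_d -> R := fun x =>
  \sum_(j < k.+1) \sum_(s : j.-tuple 'I_d) a j s x * pderiv s u x.

Definition principal_symbol (k : nat) (a : coefficients) (x xi : 'rV[R]_d) : R :=
  \sum_(s : k.-tuple 'I_d) a k s x * \prod_(i <- s) xi ord0 i.

Definition elliptic Omega (k : nat) (a : coefficients) :=
  forall x xi, Omega x -> xi != 0 -> principal_symbol k a x xi != 0.

Definition dotv (u v : 'rV[R]_d) : R := \sum_i u ord0 i * v ord0 i.

(* nu is the outward unit normal to Omega at x: near x, Omega is the set
   {rho < 0} with rho of class C^1 and grad rho (x) = c nu, c > 0. Corners of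
   the boundary have no normal. *)
Definition outward_normal Omega (x nu : 'rV[R]_d) :=
  dotv nu nu = 1 /\
  exists (U : set 'rV[R]_d) (rho : 'rV[R]_d -> R) (c : R),
    [/\ open_nbhs x U, Ck U 1 rho, rho x = 0,
        0 < c /\ (forall i, pderiv [:: i] rho x = c * nu ord0 i) &
        forall y, U y -> (Omega y <-> rho y < 0)].

Inductive boundary_condition :=
  | Periodic of 'rV[R]_d & 'rV[R]_d
  | Neumann.

Definition open_box (a b : 'rV[R]_d) : set 'rV[R]_d :=
  [set x | forall i, a ord0 i < x ord0 i < b ord0 i].

Definition bc_domain Omega (bc : boundary_condition) :=
  if bc is Periodic a b then
    (forall i, a ord0 i < b ord0 i) /\ Omega = open_box a b
  else True.

(* The normal derivative is a limit from inside, so u needs no extension past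
   the boundary. *)
Definition satisfies_bc Omega (bc : boundary_condition) (k : nat) u :=
  match bc with
  | Periodic a b => exists U : 'rV[R]_d -> R,
      [/\ Ck setT k U,
          forall x i, U (x + (b ord0 i - a ord0 i) *: basis_vec i) = U x &
          forall x, Omega x -> u x = U x]
  | Neumann => Ck Omega k u /\
      forall x nu, outward_normal Omega x nu ->
        'D_nu u (x - t *: nu) @[t --> 0^'+] --> (0 : R)
  end.

(* On the classical functions of its domain that satisfy the boundary
   condition, A acts as an elliptic differential operator of some order k > 0,
   and these functions are dense in the domain for the graph norm: this is how
   the boundary condition is encoded in the domain of A. *)
Definition elliptic_operator Omega (bc : boundary_condition)
    (D : set ('rV[R]_d -> R)) (A : ('rV[R]_d -> R) -> 'rV[R]_d -> R) :=
  exists (k : nat) (a : coefficients),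
    [/\ (0 < k)%N, elliptic Omega k a,
        forall u, D u -> satisfies_bc Omega bc k u ->
          L2_eq Omega (A u) (diffop k a u) &
        forall u, D u -> forall e : R, 0 < e -> exists v,
          [/\ D v, satisfies_bc Omega bc k v,
              L2_dist2 Omega u v < e & L2_dist2 Omega (A u) (A v) < e]].

End differential_operators.

Section scheme.
Context (R : realType) (d : nat) (Omega : set 'rV[R]_d).
Context (D : set ('rV[R]_d -> R)) (A : ('rV[R]_d -> R) -> 'rV[R]_d -> R).
Context (F : R -> R) (eps C M s dt : R).
Implicit Types phi : 'rV[R]_d -> R.

Definition energy_dom phi :=
  D phi /\ (lebesgue_rV R d).-integrable Omega (fun x => (F (phi x))%:E).

Definition energy phi : R :=
  eps ^+ 2 / 2 * inner Omega (A phi) phi +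
  \int[lebesgue_rV R d]_(x in Omega) F (phi x).

Definition ps_sav_linear_eq phi phi1 :=
  D phi1 /\
  L2_eq Omega
    (fun x => (energy phi + C) * (phi1 x + M * s * eps ^+ 2 * dt * A phi1 x))
    (fun x => - M * (eps ^+ 2 * A phi x + derive1 F (phi x))).

(* The positive root of q X^2 + (M / dt) X - (M / dt) r = 0, which is the
   R-equation of the scheme after substituting phi' - phi = dt X phi1, with
   q = (phi1, phi1). *)
Definition ps_sav_R (r q : R) : R :=
  (- (M / dt) + Num.sqrt (M ^+ 2 / dt ^+ 2 + 4 * (M / dt) * r * q)) / (2 * q).

(* The chemical potential mu is eliminated: it is - (phi' - phi) / (M dt). The
   case phi1 = 0 is understood in L^2(Omega), i.e. almost everywhere. *)
Definition ps_sav_step phi (r : R) phi' (r' : R) :=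
  exists2 phi1, ps_sav_linear_eq phi phi1 &
    (L2_eq Omega phi1 (cst 0) /\ L2_eq Omega phi' phi /\ r' = r) \/
    (~ L2_eq Omega phi1 (cst 0) /\ r' = ps_sav_R r (inner Omega phi1 phi1) /\
     L2_eq Omega phi' (fun x => phi x + dt * r' * phi1 x)).

Definition ps_sav_generated (phi : nat -> 'rV[R]_d -> R) (r : nat -> R) :=
  forall n, energy_dom (phi n) /\
            ps_sav_step (phi n) (r n) (phi n.+1) (r n.+1).

Definition diff_quotient phi phi' : 'rV[R]_d -> R :=
  fun x => (phi' x - phi x) / dt.

End scheme.

(* Main.v *)
(* If phi1 is nonzero, then q = (phi1, phi1) > 0, so that R^{n+1} is the positive
   root X of q X^2 + (M / dt) X - (M / dt) R^n = 0. This equation reads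
   X - R^n = - (dt / M) (X phi1, X phi1), and X phi1 is the difference quotient
   of phi. *)
Require Import Defs.
From mathcomp Require Import all_boot all_order all_algebra.
From mathcomp Require Import all_classical all_reals all_analysis.
From mathcomp Require Import measurable_realfun ring.
Import Order.TTheory GRing.Theory Num.Theory.
Import numFieldNormedType.Exports.
Local Open Scope classical_set_scope.
Local Open Scope ring_scope.

Set Implicit Arguments.
Unset Strict Implicit.

Section inner_product.
Context (R : realType) (d : nat) (Omega : set 'rV[R]_d).
Hypothesis mOmega : measurable Omega.
Implicit Types u v : 'rV[R]_d -> R.

Lemma inner_self_ge0 u : 0 <= inner Omega u u.
Proof. by apply: Rintegral_ge0 => x _; rewrite -expr2 sqr_ge0. Qed.

Lemma integrable_L2_sqr u : L2 Omega u ->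
  (lebesgue_rV R d).-integrable Omega (fun x => (u x * u x)%:E).
Proof. by case. Qed.

(** The scheme fixes its iterates only almost everywhere, so identities obtained from it reach
    [inner] through this lemma. Both measurability hypotheses serve [ae_eq_integral]. *)
Lemma eq_inner_self u v :
  measurable_fun Omega u -> measurable_fun Omega v -> L2_eq Omega u v ->
  inner Omega u u = inner Omega v v.
Proof.
move=> mu mv uv; congr fine; apply: ae_eq_integral => //.
- by apply/measurable_EFinP; exact: measurable_funM.
- by apply/measurable_EFinP; exact: measurable_funM.
- by apply: filterS uv => x /[apply] ->.
Qed.

Lemma inner_selfZ c u : L2 Omega u ->
  inner Omega (fun x => c * u x) (fun x => c * u x) = c ^+ 2 * inner Omega u u.
Proof.
move=> /integrable_L2_sqr iu; rewrite /inner -RintegralZl//.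
by apply: eq_Rintegral => x _; ring.
Qed.

(** The integrand is a square, hence equal to its absolute value, and a vanishing integral of an
    absolute value forces the function to vanish almost everywhere. *)
Lemma inner_self_eq0 u : L2 Omega u ->
  inner Omega u u = 0 -> L2_eq Omega u (cst 0).
Proof.
move=> L2u u0; have iu := integrable_L2_sqr L2u.
have : (\int[lebesgue_rV R d]_(x in Omega) `|(u x * u x)%:E| = 0)%E.
  under eq_integral do rewrite gee0_abs ?lee_fin -?expr2 ?sqr_ge0//.
  under eq_integral do rewrite expr2.
  (* Since [fine] also sends infinite values to 0, [inner Omega u u = 0] says something about the
     extended integral only once integrability makes that integral finite. *)
  rewrite -[LHS]fineK; last exact: integrable_fin_num.
  by congr EFin.
move/ae_eq_integral_abs => /(_ mOmega (measurable_int _ iu)).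
by apply: filterS => x /[apply] -[/eqP]; rewrite mulf_eq0 orbb => /eqP.
Qed.

Lemma inner_self_gt0 u : L2 Omega u -> ~ L2_eq Omega u (cst 0) ->
  0 < inner Omega u u.
Proof.
move=> L2u u0; rewrite lt_neqAle inner_self_ge0 andbT eq_sym.
by apply/eqP => /(inner_self_eq0 L2u).
Qed.

Lemma measurable_diff_quotient dt u v :
  measurable_fun Omega u -> measurable_fun Omega v ->
  measurable_fun Omega (diff_quotient dt u v).
Proof.
by move=> mu mv; apply: measurable_funM => //; exact: measurable_funB.
Qed.

End inner_product.

Section positive_root.
Context (R : realType) (M dt r q : R).
Hypotheses (M_gt0 : 0 < M) (dt_gt0 : 0 < dt) (r_gt0 : 0 < r) (q_gt0 : 0 < q).

Let S := Num.sqrt (M ^+ 2 / dt ^+ 2 + 4 * (M / dt) * r * q).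

Let ratio_gt0 : 0 < M / dt. Proof. exact: divr_gt0. Qed.

Let cross_gt0 : 0 < 4 * (M / dt) * r * q.
Proof. by do !apply: mulr_gt0 => //; exact: invr_gt0. Qed.

Lemma ps_sav_R_gt0 : 0 < ps_sav_R M dt r q.
Proof.
rewrite /ps_sav_R divr_gt0 ?mulr_gt0// addrC subr_gt0.
(* Writing [M / dt] as the square root of its square leaves a comparison of radicands, which differ
   by the positive cross term. *)
rewrite -[ltLHS]ger0_norm ?ltW// -sqrtr_sqr ltr_sqrt ?expr_div_n ?ltrDl//.
by rewrite addr_gt0// -expr_div_n exprn_gt0.
Qed.

Lemma ps_sav_R_subr :
  ps_sav_R M dt r q - r = - (dt / M) * (ps_sav_R M dt r q ^+ 2 * q).
Proof.
rewrite /ps_sav_R -/S.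
have SE : S ^+ 2 = M ^+ 2 / dt ^+ 2 + 4 * (M / dt) * r * q.
  by rewrite sqr_sqrtr// addr_ge0 ?ltW// -expr_div_n exprn_gt0.
(* With the root folded into [S], the only visible [r] is the subtracted one. Expressing it through
   [S] leaves a rational identity in independent quantities, which [field] settles. *)
have -> : r = (S ^+ 2 - M ^+ 2 / dt ^+ 2) / (4 * (M / dt) * q).
  by rewrite SE; field; rewrite !gt_eqF.
by field; rewrite !gt_eqF.
Qed.

End positive_root.

Theorem theorem3p2 (R : realType) (d : nat) (Omega : set 'rV[R]_d)
    (bc : boundary_condition R d)
    (D : set ('rV[R]_d -> R)) (A : ('rV[R]_d -> R) -> 'rV[R]_d -> R)
    (F : R -> R) (eps C M s dt : R)
    (phi : nat -> 'rV[R]_d -> R) (r : nat -> R)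
    (d_gt0 : (0 < d)%N)
    (Omega_open : open Omega)
    (Omega_bc : bc_domain Omega bc)
    (A_linear : linear_operator Omega D A)
    (A_self_adjoint : self_adjoint Omega D A)
    (A_elliptic : elliptic_operator Omega bc D A)
    (F_derivable : forall y : R, derivable F y 1)
    (eps_gt0 : 0 < eps) (C_gt0 : 0 < C) (M_gt0 : 0 < M) (s_gt0 : 0 < s)
    (energy_gt0 : forall psi, energy_dom Omega D F psi ->
       0 < energy Omega A F eps psi + C)
    (dt_gt0 : 0 < dt)
    (scheme : ps_sav_generated Omega D A F eps C M s dt phi r)
    (r0_gt0 : 0 < r 0%N) :
  (forall n, 0 < r n) /\
  (forall n,
     let delta := diff_quotient dt (phi n) (phi n.+1) in
     r n.+1 - r n = - (dt / M) * inner Omega delta delta /\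
     - (dt / M) * inner Omega delta delta <= 0).
Proof.
have mOmega : measurable Omega by exact: open_measurable_rV.
have mphi n : measurable_fun Omega (phi n).
  by have [[Dphi _] _] := scheme n; have [] := dom_L2 A_linear Dphi.
have r_gt0 n : 0 < r n.
  (* Either [r] is unchanged, or it becomes the root, whose positivity uses that of the previous
     value. *)
  elim: n => // n rn_gt0.
  have [_ [phi1 [Dphi1 _] [[_ [_ ->//]]|[phi1_neq0 [-> _]]]]] := scheme n.
  apply: ps_sav_R_gt0 => //.
  by apply: inner_self_gt0 => //; exact: (dom_L2 A_linear).
split=> // n delta.
have mdelta : measurable_fun Omega delta by exact: measurable_diff_quotient.
split; last first.
  by rewrite mulNr oppr_le0 mulr_ge0 ?inner_self_ge0// divr_ge0// ltW.
have [_ [phi1 [Dphi1 _]]] := scheme n.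
have L2phi1 : L2 Omega phi1 by exact: (dom_L2 A_linear).
(* Both branches of the scheme make [delta] a multiple of [phi1] almost everywhere; only the factor
   [c] differs. *)
suff delta_eq c : L2_eq Omega delta (fun x => c * phi1 x) ->
    inner Omega delta delta = c ^+ 2 * inner Omega phi1 phi1.
  move=> [[_ [phi_eq ->]]|[phi1_neq0 [rE phi_eq]]].
    (* Here [phi] and [r] do not move, so [c = 0] and both sides vanish. *)
    rewrite (delta_eq 0) ?expr0n ?mul0r ?mulr0 ?subrr//.
    apply: filterS phi_eq => x /[apply] phi_eq.
    by rewrite /delta /diff_quotient phi_eq subrr !mul0r.
  (* The increment of [phi] is [dt * r n.+1 * phi1]; dividing by [dt] leaves the factor [r n.+1]. *)
  rewrite (delta_eq (r n.+1)).
    rewrite rE; apply: ps_sav_R_subr => //; exact: inner_self_gt0.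
  apply: filterS phi_eq => x /[apply] phi_eq.
  rewrite /delta /diff_quotient phi_eq; field.
  by rewrite gt_eqF.
move=> deltaE; rewrite -inner_selfZ//; apply: eq_inner_self => //.
by apply: measurable_funM => //; case: L2phi1.
Qed.
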